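(* Let $X$ be a real Banach space, $k\in\mathbb{Z}^+$ and $r>1$. Then the following statements are equivalent. (1) $X$ is $k$-WUR. (2) If $A$ and $B$ are non-empty subsets of $X$ such that $A$ is convex, then $(A,B)$ has property $k$-$w$UC. (3) $(B_X,rS_X)$ has property $k$-$w$UC. (4) $(S_X,rS_X)$ has property $k$-$w$UC.
   Context: $B_X$ and $S_X$ are the closed unit ball and unit sphere of $X$; $X^*$ is the dual of $X$. For $x_1,\dots,x_{k+1}\in X$ and $f_1,\dots,f_k\in X^*$, $D_k[(x_i)_{i=1}^{k+1};(f_j)_{j=1}^{k}]$ denotes the determinant of the $(k+1)\times(k+1)$ matrix whose first row consists of ones and whose $(j+1,i)$ entry is $f_j(x_i)$. $X$ is $k$-weakly uniformly rotund ($k$-WUR) if for every $\epsilon>0$ and $f_1,\dots,f_k\in S_{X^*}$, $$\delta^k_X(\epsilon,(f_j)_{j=1}^k):=\inf\Big(\{1\}\cup\Big\{1-\tfrac{1}{k+1}\Big\|\sum_{i=1}^{k+1}x_i\Big\| : x_1,\dots,x_{k+1}\in S_X,\ |D_k[(x_i)_{i=1}^{k+1};(f_j)_{j=1}^{k}]|\ge\epsilon\Big\}\Big)>0.$$ For non-empty $A,B\subseteq X$, $d(A,B)=\inf\{\|x-y\|:x\in A,y\in B\}$. The pair $(A,B)$ has property $k$-weakly UC (property $k$-$w$UC) if for any sequences $(x_n^{(1)}),\dots,(x_n^{(k+1)})$ in $A$ and any sequence $(y_n)$ in $B$ with $\|x_n^{(i)}-y_n\|\to d(A,B)$ for all $1\le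 i\le k+1$, it follows that $D_k[(x_n^{(i)})_{i=1}^{k+1};(f_j)_{j=1}^{k}]\to 0$ for all $f_1,\dots,f_k\in S_{X^*}$. *)

(* Defs.v *)
From HB Require Import structures.
From mathcomp Require Import all_boot all_order all_algebra.
From mathcomp Require Import all_classical all_reals all_analysis.

Set Implicit Arguments.
Unset Strict Implicit.
Unset Printing Implicit Defensive.

Import Order.TTheory GRing.Theory Num.Theory.
Import numFieldNormedType.Exports.

Local Open Scope classical_set_scope.
Local Open Scope ring_scope.

Section Defs.
Context {R : realType} {X : normedModType R}.

Definition unit_ball : set X := [set x | `|x| <= 1].

Definition unit_sphere : set X := [set x | `|x| = 1].

(* The library has no normed dual: an element of X^* is a linear form on X
   together with a proof that it is continuous.  For such a form the supremum
   below is over a nonempty bounded set. *)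
Definition dual_norm (f : {linear X -> R^o}) : R :=
  sup [set `|f x| | x in unit_ball].

Definition dual_unit_sphere : set {linear X -> R^o} :=
  [set f : {linear X -> R^o} | continuous f /\ dual_norm f = 1].

Definition Dk (k : nat) (x : 'I_k.+1 -> X) (f : 'I_k -> {linear X -> R^o}) : R :=
  \det (col_mx (const_mx 1 : 'rV[R]_k.+1) (\matrix_(j < k, i < k.+1) f j (x i))).

Definition kWUR_modulus (k : nat) (eps : R) (f : 'I_k -> {linear X -> R^o}) : R :=
  inf ([set 1] `|`
       [set 1 - k.+1%:R^-1 * `|\sum_(i < k.+1) x i| | x in
         [set x : 'I_k.+1 -> X |
           (forall i, unit_sphere (x i)) /\ eps <= `|Dk x f|]]).

(* Meaningful for nonempty A and B only; inf of the empty set is 0. *)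
Definition set_dist (A B : set X) : R :=
  inf [set `|x - y| | x in A & y in B].

Definition k_wUC (k : nat) (A B : set X) : Prop :=
  forall (x : 'I_k.+1 -> nat -> X) (y : nat -> X),
    (forall i n, A (x i n)) -> (forall n, B (y n)) ->
    (forall i, `|x i n - y n| @[n --> \oo] --> set_dist A B) ->
    forall f : 'I_k -> {linear X -> R^o},
      (forall j, dual_unit_sphere (f j)) ->
      Dk (x ^~ n) f @[n --> \oo] --> (0 : R).

End Defs.

Arguments unit_ball {R} X.
Arguments unit_sphere {R} X.

Definition kWUR (R : realType) (X : normedModType R) (k : nat) : Prop :=
  forall (eps : R) (f : 'I_k -> {linear X -> R^o}), 0 < eps ->
    (forall j, dual_unit_sphere (f j)) -> 0 < kWUR_modulus eps f.

(* Main.v *)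
(* Adding a common vector to all x_i, or scaling them, acts on the matrix of
   D_k by a lower triangular factor, so D_k (c + t x) = t^k D_k x; moreover D_k
   is uniformly continuous on bounded sets, since |f_j x| <= |x|.

   (1) => (2): put u_i = x_i - y.  By convexity the mean of the x_i lies in A,
   so the mean of the u_i has norm at least d = d(A, B), while |u_i| -> d.  If
   d > 0 the unit vectors u_i / |u_i| therefore have means of norm tending to 1,
   and k-WUR forces D_k -> 0; if d = 0 then u_i -> 0.

   (4) => (1): given unit vectors x_i whose mean a has norm close to 1, shrink
   them towards a: w_i = (1 - t) a + t x_i with 0 < t <= 1 and t k <= r - 1.
   Then r a - w_i = (r - 1 - t k) a + t (sum of the x_j, j <> i) has norm at most
   r - 1, whence also |w_i| >= r |a| - (r - 1).  Normalizing w_i and a gives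
   points of the spheres of radii 1 and r at distance close to r - 1, so
   t^k D_k x = D_k w is small. *)
Require Import Defs.
From HB Require Import structures.
From mathcomp Require Import all_boot all_order all_algebra.
From mathcomp Require Import all_classical all_reals all_analysis.
From mathcomp Require Import ring lra.

Set Implicit Arguments.
Unset Strict Implicit.
Unset Printing Implicit Defensive.

Import Order.TTheory GRing.Theory Num.Theory.
Import numFieldNormedType.Exports.

Local Open Scope classical_set_scope.
Local Open Scope ring_scope.

(** * Null real sequences and perturbation of determinants *)

Section NullSequences.
Context {R : realType}.
Implicit Types a b c d : nat -> R.

Lemma cvg0_dominated a b : (forall n, `|a n| <= b n) ->
  b n @[n --> \oo] --> (0 : R) -> a n @[n --> \oo] --> (0 : R).
Proof.
move=> ab b0; apply: norm_cvg0.
apply: (@squeeze_cvgr _ _ _ _ (fun=> 0) b); [|exact: cvg_cst|exact: b0].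
by apply: nearW => n; rewrite normr_ge0 ab.
Qed.

Lemma cvg0_bounded_mul a b (C : R) : (forall n, `|a n| <= C) ->
  b n @[n --> \oo] --> (0 : R) -> a n * b n @[n --> \oo] --> (0 : R).
Proof.
move=> aC b0; apply: (@cvg0_dominated _ (fun n => C * `|b n|)).
  by move=> n; rewrite normrM ler_wpM2r.
by rewrite -(mulr0 C); apply: cvgMr; apply/norm_cvg0P.
Qed.

Lemma cvg0_sum (I : Type) (s : seq I) (P : pred I) (F : I -> nat -> R) :
  (forall i, P i -> F i n @[n --> \oo] --> (0 : R)) ->
  \sum_(i <- s | P i) F i n @[n --> \oo] --> (0 : R).
Proof.
move=> F0; elim: s => [|i s IH].
  by under eq_fun do rewrite big_nil; exact: cvg_cst.
under eq_fun do rewrite big_cons; have [Pi|//] := boolP (P i).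
by have := cvgD (F0 i Pi) IH; rewrite addr0; exact.
Qed.

(** Writing [b = a - (a - b)] and [d = c - (c - d)] leaves bounded-times-null terms and a product of
    two null sequences, so bounds on [a] and [c] suffice. *)
Lemma sub_mul_cvg0 a b c d (C : R) :
  (forall n, `|a n| <= C) -> (forall n, `|c n| <= C) ->
  a n - b n @[n --> \oo] --> (0 : R) -> c n - d n @[n --> \oo] --> (0 : R) ->
  a n * c n - b n * d n @[n --> \oo] --> (0 : R).
Proof.
move=> aC cC ab cd.
rewrite (_ : (fun n => _) = (fun n => (a n * (c n - d n) +
  c n * (a n - b n)) - (a n - b n) * (c n - d n))); last first.
  by apply/funext => n; ring.
rewrite -(subrr (0 : R)) -{1}(addr0 (0 : R)).
apply: cvgB; first by apply: cvgD; apply: cvg0_bounded_mul; eassumption.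
by rewrite -(mulr0 (0 : R)); apply: cvgM.
Qed.

Lemma sub_prod_cvg0 (I : Type) (s : seq I) (F G : I -> nat -> R) (C : R) :
  (forall i n, `|F i n| <= C) ->
  (forall i, F i n - G i n @[n --> \oo] --> (0 : R)) ->
  \prod_(i <- s) F i n - \prod_(i <- s) G i n @[n --> \oo] --> (0 : R).
Proof.
move=> FC FG; elim: s => [|i s IH].
  by under eq_fun do rewrite !big_nil subrr; exact: cvg_cst.
under eq_fun do rewrite !big_cons.
(* One constant for both factors: [C] bounds the head, [C ^+ size s] the remaining product. *)
apply: (@sub_mul_cvg0 _ _ _ _ (Num.max C (C ^+ size s))) => //.
  by move=> n; rewrite le_max FC.
move=> n; rewrite le_max; apply/orP; right.
elim: s {IH} => [|j s IH]; first by rewrite big_nil normr1.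
by rewrite big_cons normrM /= exprS ler_pM.
Qed.

(** By the Leibniz formula, the difference is a finite signed sum of differences of products. *)
Lemma sub_det_cvg0 m (A B : nat -> 'M[R]_m) (C : R) :
  (forall i j n, `|A n i j| <= C) ->
  (forall i j, A n i j - B n i j @[n --> \oo] --> (0 : R)) ->
  \det (A n) - \det (B n) @[n --> \oo] --> (0 : R).
Proof.
move=> AC AB; rewrite /determinant.
under eq_fun do rewrite -sumrB; apply: cvg0_sum => s _.
under eq_fun do rewrite -mulrBr.
apply: (@cvg0_bounded_mul (fun=> _) _ 1) => [_|]; first by rewrite normr_sign.
by apply: (@sub_prod_cvg0 _ _ _ _ C).
Qed.

End NullSequences.

(** * Affine behaviour and continuity of [Dk] *)

Section Dk.
Context {R : realType} {X : normedModType R}.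
Implicit Types x : X.

Lemma dual_unit_sphere_le (f : {linear X -> R^o}) x :
  dual_unit_sphere f -> `|f x| <= `|x|.
Proof.
case=> _; rewrite /dual_norm; set E := [set _ | _ in _] => supE.
(* sup of an unbounded set is 0 by convention, so sup E = 1 bounds E. *)
have [E0 Eub] : has_sup E.
  apply: contrapT => /sup_out E0.
  by move: supE; rewrite E0 => /esym/eqP; rewrite oner_eq0.
have [->|x0] := eqVneq x 0; first by rewrite linear0 !normr0.
have nx : 0 < `|x| by rewrite normr_gt0.
have : `|f (`|x|^-1 *: x)| <= 1.
  rewrite -supE; apply: ub_le_sup => //; exists (`|x|^-1 *: x) => //=.
  by rewrite /unit_ball /= normrZ normfV normr_id mulVf ?gt_eqF.
by rewrite linearZ /= normrM normfV normr_id ler_pdivrMl // mulr1.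
Qed.

Lemma Dk_affine k (c : X) (t : R) (x : 'I_k.+1 -> X) (f : 'I_k -> {linear X -> R^o}) :
  Dk (fun i => c + t *: x i) f = t ^+ k * Dk x f.
Proof.
(* The first column of [T] multiplies the row of ones, which adds [f j c] to every entry of row
   [j]. *)
pose T : 'M[R]_(1 + k) := block_mx 1%:M 0 (\col_j (f j c : R)) t%:M.
have detT : \det T = t ^+ k by rewrite det_lblock det1 mul1r det_scalar.
rewrite /Dk -detT -det_mulmx; congr (\det _).
rewrite (@mul_block_col _ 1 k 1 k k.+1) !mul1mx mul0mx addr0 mul_scalar_mx.
congr col_mx; apply/matrixP => j i; rewrite !mxE big_ord1 !mxE mulr1.
by rewrite linearD linearZ.
Qed.

Lemma sub_Dk_cvg0 k (x y : 'I_k.+1 -> nat -> X) (C : R)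
    (f : 'I_k -> {linear X -> R^o}) :
  (forall j, dual_unit_sphere (f j)) ->
  (forall i n, `|x i n| <= C) ->
  (forall i, `|x i n - y i n| @[n --> \oo] --> (0 : R)) ->
  Dk (x ^~ n) f - Dk (y ^~ n) f @[n --> \oo] --> (0 : R).
Proof.
(* The 1 covers the row of ones, [C] the entries [f j (x i n)]. *)
move=> fS xC xy; apply: (@sub_det_cvg0 _ _ _ _ (Num.max 1 C)).
  move=> i j n; rewrite !mxE; case: (fintype.split _) => l; rewrite mxE le_max.
    by rewrite normr1 lexx.
  by apply/orP; right; apply: le_trans (dual_unit_sphere_le _ (fS l)) (xC _ _).
move=> i j; under eq_fun do rewrite !mxE.
case: (fintype.split _) => l; under eq_fun do rewrite !mxE.
  by under eq_fun do rewrite subrr; exact: cvg_cst.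
apply: cvg0_dominated (xy j) => n; rewrite -linearB.
exact: dual_unit_sphere_le.
Qed.

Lemma Dk_cvg0_near k (x y : 'I_k.+1 -> nat -> X) (C : R)
    (f : 'I_k -> {linear X -> R^o}) :
  (forall j, dual_unit_sphere (f j)) ->
  (forall i n, `|x i n| <= C) ->
  (forall i, `|x i n - y i n| @[n --> \oo] --> (0 : R)) ->
  Dk (x ^~ n) f @[n --> \oo] --> (0 : R) -> Dk (y ^~ n) f @[n --> \oo] --> (0 : R).
Proof.
move=> fS xC xy Dx; rewrite -(subrr (0 : R)).
rewrite (_ : (fun n => _) = (fun n => Dk (x ^~ n) f - (Dk (x ^~ n) f - Dk (y ^~ n) f))).
  by apply: cvgB => //; exact: sub_Dk_cvg0 xC xy.
by apply/funext => n; rewrite opprB addrC subrK.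
Qed.

End Dk.

(** * Means in convex sets and distances between sets *)

Section MeanAndDistance.
Context {R : realType} {X : normedModType R}.
Implicit Types (A B : set X) (x y : X).

Lemma norm_sum_ord_le m (x : 'I_m -> X) (C : R) :
  (forall i, `|x i| <= C) -> `|\sum_i x i| <= m%:R * C.
Proof.
move=> xC; apply: (le_trans (ler_norm_sum _ _ _)).
by apply: (le_trans (ler_sum _ (fun i _ => xC i))); rewrite sumr_const card_ord mulr_natl.
Qed.

(** Induction: the mean of [m.+2] points combines the mean of the first [m.+1], with weight
    [m.+1 / m.+2], and the last point. *)
Lemma convex_set_mean A m (x : 'I_m.+1 -> X) : convex_set A ->
  (forall i, A (x i)) -> A (m.+1%:R^-1 *: \sum_i x i).
Proof.
move=> cA; elim: m x => [|m IH] x Ax; first by rewrite big_ord1 invr1 scale1r.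
have t0 : 0 <= m.+1%:R / m.+2%:R :> R by rewrite divr_ge0.
have t1 : m.+1%:R / m.+2%:R <= 1 :> R by rewrite ler_pdivrMr ?mul1r ?ler_nat.
set t := _ / _ in t0 t1.
have : A (t *: (m.+1%:R^-1 *: \sum_i x (widen_ord (leqnSn _) i)) + (1 - t) *: x ord_max).
  apply: set_mem; apply: (cA _ _ (Itv01 t0 t1)); apply: mem_set => //.
  exact: IH.
rewrite (big_ord_recr m.+1) /= scalerDr scalerA /t.
have -> : m.+1%:R / m.+2%:R / m.+1%:R = m.+2%:R^-1 :> R.
  by field; rewrite ?nat1r -?natrD !pnatr_eq0.
have -> // : 1 - m.+1%:R / m.+2%:R = m.+2%:R^-1 :> R.
by field; rewrite ?nat1r -?natrD !pnatr_eq0.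
Qed.

Lemma set_dist_le A B x y : A x -> B y -> set_dist A B <= `|x - y|.
Proof.
move=> Ax By; apply: ge_inf; last by exists x => //; exists y.
by exists 0 => _ [? _ [? _ <-]].
Qed.

Lemma le_set_dist A B (d : R) : A !=set0 -> B !=set0 ->
  (forall x y, A x -> B y -> d <= `|x - y|) -> d <= set_dist A B.
Proof.
move=> [x Ax] [y By] dAB; apply: lb_le_inf.
  by exists `|x - y|, x => //; exists y.
by move=> _ [x' Ax' [y' By' <-]]; exact: dAB.
Qed.

(** The value is attained at [z] and [r *: z]; the reverse triangle inequality gives the lower
    bound. Both the ball and the sphere qualify as [A]. *)
Lemma set_dist_scaled_sphere A (r : R) : 1 < r -> unit_sphere X !=set0 ->
  unit_sphere X `<=` A -> A `<=` unit_ball X ->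
  set_dist A [set r *: x | x in unit_sphere X] = r - 1.
Proof.
move=> r1 [z Sz] SA AB; apply/le_anti/andP; split.
  apply: (le_trans (set_dist_le (SA _ Sz) (imageP _ Sz))).
  rewrite -{1}(scale1r z) -scalerBl normrZ (Sz : `|z| = 1) mulr1 distrC ger0_norm //.
  by rewrite subr_ge0 ltW.
apply: le_set_dist; [by exists z; exact: SA|by exists (r *: z), z|].
move=> x _ /AB x1 [w Sw <-]; rewrite distrC.
apply: le_trans (lerB_dist _ _); rewrite normrZ (Sw : `|w| = 1) mulr1 ger0_norm; last lra.
by apply: lerB => //; exact: x1.
Qed.

End MeanAndDistance.

(** * The modulus of rotundity as an infimum *)

Section Modulus.
Context {R : realType} {X : normedModType R} {k : nat}.
Implicit Types (x : 'I_k.+1 -> X) (f : 'I_k -> {linear X -> R^o}).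

Lemma mean_norm_le1 x : (forall i, `|x i| <= 1) -> k.+1%:R^-1 * `|\sum_i x i| <= 1.
Proof. by move=> x1; rewrite ler_pdivrMl // norm_sum_ord_le. Qed.

Lemma kWUR_modulus_le (eps : R) f x : (forall i, unit_sphere X (x i)) ->
  eps <= `|Dk x f| -> kWUR_modulus eps f <= 1 - k.+1%:R^-1 * `|\sum_i x i|.
Proof.
move=> Sx Dx; apply: ge_inf; last by right; exists x.
exists 0 => _ [->//|[y [Sy _] <-]].
by rewrite subr_ge0 mean_norm_le1 // => i; rewrite (Sy i : `|_| = 1).
Qed.

Lemma kWUR_modulus_lt (eps eta : R) f : kWUR_modulus eps f < eta -> eta <= 1 ->
  exists x, [/\ forall i, unit_sphere X (x i), eps <= `|Dk x f| &
    1 - k.+1%:R^-1 * `|\sum_i x i| < eta].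
Proof.
move=> /inf_lt []; first by exists 1; left.
(* [eta <= 1] excludes the value 1 adjoined to the infimum. *)
move=> _ [->|[x [Sx Dx] <-]] lt_eta le1; first by rewrite ltNge le1 in lt_eta.
by exists x.
Qed.

End Modulus.

(** * From rotundity to convex sets: (1) => (2) *)

Lemma kWUR_k_wUC (R : realType) (X : normedModType R) (k : nat) (A B : set X) :
  (0 < k)%N -> kWUR X k -> A !=set0 -> B !=set0 -> convex_set A -> k_wUC k A B.
Proof.
move=> k0 rotX A0 B0 cA x y Ax By xy f fS; set d := set_dist A B in xy.
pose u i n := x i n - y n.
have Dxu n : Dk (x ^~ n) f = Dk (u ^~ n) f.
  rewrite -[RHS]mul1r -(expr1n _ k) -(Dk_affine (y n)); congr Dk.
  by apply/funext => i; rewrite scale1r addrC subrK.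
under eq_fun do rewrite Dxu.
have du i n : d <= `|u i n| by apply: set_dist_le.
have : 0 <= d by apply: le_set_dist.
rewrite le_eqVlt => /predU1P[d0|d0].
  (* Scaling by 0 gives the factor [0 ^+ k], which vanishes because [0 < k]. *)
  have D0 : Dk (fun=> 0 : X) f = 0.
    have := Dk_affine 0 0 (fun=> 0) f.
    by rewrite expr0n gtn_eqF // mul0r; under eq_fun do rewrite scaler0 addr0.
  apply: (@Dk_cvg0_near _ _ _ (fun _ _ => 0) u 0) => // [i n|i|].
  - by rewrite normr0.
  - under eq_fun do rewrite sub0r normrN.
    by rewrite d0; exact: xy.
  - by under eq_fun do rewrite D0; exact: cvg_cst.
have u0 i n : 0 < `|u i n| by exact: lt_le_trans (du i n).
pose v i n := `|u i n|^-1 *: u i n.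
have Sv i n : `|v i n| = 1 by rewrite normrZ normfV normr_id mulVf ?gt_eqF.
(* Both vectors are nonnegative multiples of [v i n], so only their lengths differ. *)
have duv i n : `|d *: v i n - u i n| = `|u i n| - d.
  have -> : d *: v i n - u i n = (d - `|u i n|) *: v i n.
    by rewrite scalerBl -[in LHS](scale1r (u i n)) -(divff (lt0r_neq0 (u0 i n))) -scalerA.
  by rewrite normrZ Sv mulr1 distrC ger0_norm // subr_ge0.
have Dv : Dk (v ^~ n) f @[n --> \oo] --> (0 : R).
  apply/cvgr0Pnorm_lt => e e0; set delta := kWUR_modulus e f.
  have delta0 : 0 < delta by exact: rotX.
  have unear : \forall n \near \oo, forall i, `|u i n| < d + d * (delta / 2).
    apply: filter_forall => i; apply: (cvgr_lt _ (xy i)).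
    by rewrite ltrDl mulr_gt0 // divr_gt0.
  near=> n; rewrite ltNge; apply/negP => De.
  have := kWUR_modulus_le (Sv ^~ n) De; rewrite -/delta leNgt => /negP; apply.
  have un : forall i, `|u i n| < d + d * (delta / 2) by near: n; exact: unear.
  have k1 : 0 < k.+1%:R :> R by [].
  have umean : d * k.+1%:R <= `|\sum_i u i n|.
    have := set_dist_le (convex_set_mean cA (Ax ^~ n)) (By n); rewrite -/d.
    have -> : k.+1%:R^-1 *: (\sum_i x i n) - y n = k.+1%:R^-1 *: \sum_i u i n.
      rewrite sumrB scalerBr sumr_const card_ord; congr (_ - _).
      by rewrite -(scaler_nat _ (y n)) scalerA mulVf // scale1r.
    by rewrite normrZ gtr0_norm ?invr_gt0 // ler_pdivlMl // mulrC.
  have uv : `|\sum_i u i n| <= d * `|\sum_i v i n| + k.+1%:R * (d * (delta / 2)).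
    have -> : \sum_i u i n = d *: \sum_i v i n - \sum_i (d *: v i n - u i n).
      by rewrite [X in _ - X]sumrB -scaler_sumr opprB addrC subrK.
    apply: (le_trans (ler_normB _ _)); rewrite normrZ gtr0_norm // lerD2l.
    by apply: norm_sum_ord_le => i; rewrite duv lerBlDl ltW.
  have : k.+1%:R <= `|\sum_i v i n| + k.+1%:R * (delta / 2).
    rewrite -(ler_pM2l d0) (le_trans umean) // (le_trans uv) //.
    by rewrite mulrDr mulrCA.
  rewrite -lerBlDr -[X in X - _]mulr1 -mulrBr -ler_pdivlMl //.
  by set M := _^-1 * _ => ?; clearbody M; lra.
apply: (@Dk_cvg0_near _ _ _ (fun i n => d *: v i n) u d) => // [i n|i|].
- by rewrite normrZ Sv mulr1 gtr0_norm.
- under eq_fun do rewrite duv.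
  by rewrite -(subrr d); apply: cvgB; [exact: xy|exact: cvg_cst].
- have Ddv n : Dk (fun i => d *: v i n) f = d ^+ k * Dk (v ^~ n) f.
    by rewrite -(Dk_affine 0); congr Dk; apply/funext => i; rewrite add0r.
  by under eq_fun do rewrite Ddv; rewrite -(mulr0 (d ^+ k)); exact: cvgMr.
Unshelve. all: by end_near. Qed.

(** * From the pair of spheres back to rotundity: (4) => (1) *)

Lemma k_wUC_sphere_kWUR (R : realType) (X : normedModType R) (k : nat) (r : R) :
  (0 < k)%N -> 1 < r ->
  k_wUC k (unit_sphere X) [set r *: x | x in unit_sphere X] -> kWUR X k.
Proof.
move=> k0 r1 wUC e f e0 fS; rewrite ltNge; apply/negP => mod_le0.
have r0 : 0 < r by lra.
have kR0 : 0 < k%:R :> R by rewrite ltr0n.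
have h1 n : harmonic n <= 1 :> R by rewrite /harmonic /= invf_le1 // ler1n.
(* A nonpositive modulus supplies such a tuple for each [n]; the factor [r^-1] absorbs the later
   multiplication of the mean by [r]. *)
have /choice[x xP] : forall n, exists x : 'I_k.+1 -> X,
    [/\ forall i, unit_sphere X (x i), e <= `|Dk x f| &
      1 - k.+1%:R^-1 * `|\sum_i x i| < r^-1 * harmonic n].
  move=> n; apply: kWUR_modulus_lt.
    by rewrite (le_lt_trans mod_le0) // mulr_gt0 ?invr_gt0 // harmonic_gt0.
  by rewrite ler_pdivrMl // mulr1 (le_trans (h1 n)) // ltW.
(* [t <= 1] makes [w i n] a convex combination; [t * k <= r - 1] keeps the coefficient of [a n] in
   [r *: a n - w i n] nonnegative. *)
pose t := Num.min 1 ((r - 1) / k%:R).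
have t0 : 0 < t by rewrite lt_min ltr01 divr_gt0 // subr_gt0.
have t1 : t <= 1 by rewrite ge_min lexx.
have tk : t * k%:R <= r - 1 by rewrite -ler_pdivlMr // ge_min lexx orbT.
pose a n := k.+1%:R^-1 *: \sum_i x n i.
pose w i n := (1 - t) *: a n + t *: x n i.
have nx i n : `|x n i| = 1 by have [/(_ i)] := xP n.
have na n : `|a n| = k.+1%:R^-1 * `|\sum_i x n i|.
  by rewrite normrZ gtr0_norm ?invr_gt0.
have a1 n : `|a n| <= 1 by rewrite na mean_norm_le1 // => i; rewrite nx.
have ah n : r * (1 - `|a n|) < harmonic n.
  by have [_ _] := xP n; rewrite -na ltr_pdivlMl.
have a0 n : 0 < `|a n|.
  by have := lt_le_trans (ah n) (h1 n); nra.
have w1 i n : `|w i n| <= 1.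
  rewrite (le_trans (ler_normD _ _)) // (normrZ (1 - t)) (normrZ t) nx.
  rewrite !ger0_norm ?subr_ge0 ?(ltW t0) // mulr1 -lerBrDr.
  by rewrite ler_piMr ?subr_ge0.
have raw i n : `|r *: a n - w i n| <= r - 1.
  (* This vector is the sum of the other [k] unit vectors. *)
  have rest : `|k.+1%:R *: a n - x n i| <= k%:R.
    rewrite scalerA divff // scale1r (bigD1 i) //= addrAC subrr add0r.
    apply: (le_trans (ler_norm_sum _ _ _)); rewrite (eq_bigr (fun=> 1)) //.
    by rewrite sumr_const cardC1 card_ord.
  have -> : r *: a n - w i n =
      (r - 1 - t * k%:R) *: a n + t *: (k.+1%:R *: a n - x n i).
    rewrite /w; move: (a n) (x n i) => p q.
    rewrite opprD addrA -scalerBl (scalerBr t) scalerA addrA -scalerDl.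
    by congr (_ *: _ - _); rewrite -natr1; ring.
  rewrite (le_trans (ler_normD _ _)) // (normrZ (_ - _)) (normrZ t).
  rewrite !ger0_norm ?subr_ge0 ?(ltW t0) //.
  by rewrite -[leRHS](subrK (t * k%:R)) lerD ?ler_pM2l // ler_piMr ?subr_ge0.
have wh i n : 1 - `|w i n| < harmonic n.
  have := lerB_dist (r *: a n) (w i n); rewrite normrZ gtr0_norm //.
  by have := raw i n; have := ah n; lra.
have w0 i n : 0 < `|w i n| by have := wh i n; have := h1 n; lra.
pose z i n := `|w i n|^-1 *: w i n.
pose y n := r *: (`|a n|^-1 *: a n).
have Sz i n : unit_sphere X (z i n).
  by rewrite /unit_sphere /= normrZ normfV normr_id mulVf ?gt_eqF.
have Sa n : unit_sphere X (`|a n|^-1 *: a n).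
  by rewrite /unit_sphere /= normrZ normfV normr_id mulVf ?gt_eqF.
have normalize (p : X) : 0 < `|p| -> `| (`|p|^-1 *: p) - p| = `|1 - `|p| |.
  move=> p0; rewrite -[X in _ - X]scale1r -scalerBl normrZ -[X in _ * X]gtr0_norm //.
  by rewrite -normrM mulrBl mulVf ?gt_eqF // mul1r.
have zw i n : `|z i n - w i n| <= harmonic n.
  by rewrite normalize // ger0_norm ?subr_ge0 // ltW.
have yra n : `|y n - r *: a n| <= harmonic n.
  rewrite -scalerBr normrZ gtr0_norm // normalize // ger0_norm ?subr_ge0 //.
  exact: ltW.
have S0 : unit_sphere X !=set0 by exists (z ord0 0%N); exact: Sz.
have distS : set_dist (unit_sphere X) [set r *: x | x in unit_sphere X] = r - 1.
  by apply: set_dist_scaled_sphere => // p; rewrite /unit_sphere /unit_ball /= => ->.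
have Dz : Dk (z ^~ n) f @[n --> \oo] --> (0 : R).
  apply: (wUC z y) => // [n|i]; first by exists (`|a n|^-1 *: a n).
  rewrite distS.
  (* Normalizing [w i n] and [a n] costs at most [harmonic n] each, on top of the bound [r - 1] for
     the unnormalized pair. *)
  apply: (@squeeze_cvgr _ _ _ _ (fun=> r - 1) (fun n => r - 1 + (harmonic n + harmonic n))).
  - apply: nearW => n; apply/andP; split.
      by rewrite -distS; apply: set_dist_le => //; exists (`|a n|^-1 *: a n).
    have -> : z i n - y n = (z i n - w i n) - (r *: a n - w i n) - (y n - r *: a n).
      by rewrite !opprB !subrKA.
    rewrite (le_trans (ler_normB _ _)) // addrA lerD //.
    by rewrite (le_trans (ler_normB _ _)) // addrC lerD.
  - exact: cvg_cst.
  - rewrite -[X in _ --> X]addr0; apply: cvgD; first exact: cvg_cst.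
    by rewrite -(addr0 (0 : R)); apply: cvgD; exact: cvg_harmonic.
have Dw : Dk (w ^~ n) f @[n --> \oo] --> (0 : R).
  apply: (Dk_cvg0_near (C := 1) fS _ _ Dz) => [i n|i]; first by rewrite Sz.
  by apply: cvg0_dominated cvg_harmonic => n; rewrite normr_id; exact: zw.
(* Contradiction: [|Dk|] at [w] equals [t ^+ k] times [|Dk|] at [x n], hence is at least
   [t ^+ k * e] for all [n]. *)
have te0 : 0 < t ^+ k * e by rewrite mulr_gt0 // exprn_gt0.
have [n] := filter_ex (cvgr0_norm_lt _ Dw _ te0).
rewrite /= Dk_affine normrM ger0_norm ?exprn_ge0 ?(ltW t0) //.
rewrite ltr_pM2l ?exprn_gt0 // ltNge.
by have [_ ->] := xP n.
Qed.

(** * The cycle of implications *)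

Theorem theorem3p13 (R : realType) (X : completeNormedModType R) (k : nat) (r : R)
    (hk : (0 < k)%N) (hr : 1 < r) :
  [<-> kWUR X k;
       forall A B : set X, A !=set0 -> B !=set0 -> convex_set A -> k_wUC k A B;
       k_wUC k (unit_ball X) [set r *: x | x in unit_sphere X];
       k_wUC k (unit_sphere X) [set r *: x | x in unit_sphere X] ].
Proof.
have S_sub_B : unit_sphere X `<=` unit_ball X.
  by move=> x; rewrite /unit_sphere /unit_ball /= => ->.
tfae.
- by move=> rotX A B A0 B0; exact: kWUR_k_wUC.
- move=> wUC x y Bx Sy; apply: wUC => //.
  + by exists 0; rewrite /unit_ball /= normr0.
  + by exists (y 0%N).
  (* Convexity of the unit ball. *)
  + move=> p q l; rewrite !inE /unit_ball /= => p1 q1.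
    rewrite (le_trans (ler_normD _ _)) // !normrZ.
    have l0 : 0 <= l%:num by [].
    have l1 : l%:num <= 1 by [].
    rewrite !ger0_norm ?subr_ge0 //.
    have -> : 1 = l%:num * 1 + (1 - l%:num) * 1 :> R by ring.
    by rewrite lerD // ler_wpM2l ?subr_ge0.
- move=> wUC x y Sx Sy xy; apply: wUC => //; first by move=> i n; exact: S_sub_B.
  (* The ball and the sphere are both at distance [r - 1] from the larger sphere, so the hypothesis
     on [x] and [y] carries over. *)
  have S0 : unit_sphere X !=set0 by have [p Sp _] := Sy 0%N; exists p.
  by rewrite set_dist_scaled_sphere // -(set_dist_scaled_sphere hr S0 (@subset_refl _ _) S_sub_B).
- exact: k_wUC_sphere_kWUR.
Qed.
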